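(* Let $m\ge 2$ be an integer and let $p=(p_1,\ldots,p_m)$ be a discrete probability density with support $S=\{1,\ldots,m\}$, i.e. $p_i>0$ for all $i\in S$ and $\sum_{i=1}^m p_i=1$. Let elements be drawn in sequence, independently, from this distribution. For $1\le i\le m$ let $X_i$ be the number of additional draws needed to go from the $(i-1)$-th to the $i$-th different value in the sample (so $X_1=1$), and let $X_m(k)=X_1+\cdots+X_k$ be the number of draws needed to observe $k$ different values. For pairwise distinct indices $i_1,\ldots,i_r\in S$ write $p(i_1,\ldots,i_r)=1-p_{i_1}-\cdots-p_{i_r}$. Then for every $k\in\{2,\ldots,m\}$, $$\mathbb{E}[X_k]=\sum_{\substack{i_1,\ldots,i_{k-1}\in\{1,\ldots,m\}\\ \text{pairwise distinct}}}\frac{p_{i_1}\cdots p_{i_{k-1}}}{p(i_1)\,p(i_1,i_2)\cdots p(i_1,\ldots,i_{k-1})},$$ and therefore $$\mathbb{E}[X_m(k)]=\sum_{s=1}^{k}\mathbb{E}[X_s]=1+\sum_{s=2}^{k}\ \sum_{\substack{i_1,\ldots,i_{s-1}\in\{1,\ldots,m\}\\ \text{pairwise distinct}}}\frac{p_{i_1}\cdots p_{i_{s-1}}}{p(i_1)\,p(i_1,i_2)\cdots p(i_1,\ldots,i_{s-1})}.$$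
   Context: Formally, let $(\xi_n)_{n\ge 1}$ be i.i.d. random variables with $\mathbb{P}[\xi_n=i]=p_i$ for $i\in S=\{1,\ldots,m\}$. For $1\le j\le m$ let $T_j=\min\{n\ge 1: |\{\xi_1,\ldots,\xi_n\}|=j\}$ be the first time at which $j$ different values have been observed (almost surely finite), with $T_0=0$. Then $X_j=T_j-T_{j-1}$ and $X_m(k)=T_k$. The sums run over ordered tuples of pairwise distinct indices. *)

(* Defs.v *)
From HB Require Import structures.
From mathcomp Require Import all_boot all_order all_algebra finmap.
From mathcomp Require Import all_classical all_reals all_analysis.

Set Implicit Arguments.
Unset Strict Implicit.
Unset Printing Implicit Defensive.

Import Order.TTheory GRing.Theory Num.Theory.

Local Open Scope classical_set_scope.
Local Open Scope ring_scope.

(* The m values {1, ..., m} are represented by 'I_m = {0, ..., m - 1}, and the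
   draws are numbered from 0: [xi n w] is the (n + 1)-st draw. *)

Section Draws.
Context {d : measure_display} {Omega : measurableType d} {R : realType}.
Variables (P : probability Omega R) (m : nat).

(* The sigma-algebra on the finite set 'I_m is its power set, so the events of
   a random variable X are the preimages of arbitrary subsets of 'I_m. *)
Definition finite_valued_rv (X : Omega -> 'I_m) : Prop :=
  forall A : set 'I_m, measurable (X @^-1` A).

Definition mutually_independent (xi : nat -> Omega -> 'I_m) : Prop :=
  forall (J : {fset nat}) (A : nat -> set 'I_m),
    P (\bigcap_(n in [set` J]) (xi n @^-1` A n)) =
      (\prod_(n <- J) P (xi n @^-1` A n))%E.

End Draws.

Section CollectionTimes.
Context {Omega : Type} {R : realType} {m : nat}.
Variable xi : nat -> Omega -> 'I_m.

Definition nb_seen (n : nat) (w : Omega) : nat := #|[seq xi i w | i : 'I_n]|.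

(* T_j.  A nonempty set of natural numbers contains its [inf], so this is the
   minimum.  On the null event where the j-th different value never shows up
   the set is empty and [inf] is 0. *)
Definition collection_time (j : nat) (w : Omega) : R :=
  if j is 0 then 0
  else inf [set n%:R | n in [set n : nat | (1 <= n)%N /\ nb_seen n w = j]].

Definition waiting_time (j : nat) (w : Omega) : R :=
  collection_time j w - collection_time j.-1 w.

Definition nb_draws (k : nat) (w : Omega) : R :=
  \sum_(1 <= j < k.+1) waiting_time j w.

Lemma nb_drawsE (k : nat) (w : Omega) : nb_draws k w = collection_time k w.
Proof.
rewrite /nb_draws big_add1 /= /waiting_time /=.
by rewrite (telescope_sumr (fun j => collection_time j w)) //= subr0.
Qed.

End CollectionTimes.

Arguments collection_time {Omega} R {m} xi j w.
Arguments waiting_time {Omega} R {m} xi j w.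
Arguments nb_draws {Omega} R {m} xi k w.

Section TupleSum.
Context {R : realType} {m : nat}.
Variable p : 'I_m -> R.

(* p(i_1, ..., i_r) *)
Definition comp_prob (s : seq 'I_m) : R := 1 - \sum_(i <- s) p i.

(* Sum over the ordered (i_1, ..., i_q) with pairwise distinct entries of
   p_{i_1} ... p_{i_q} / (p(i_1) p(i_1, i_2) ... p(i_1, ..., i_q)). *)
Definition distinct_sum (q : nat) : R :=
  \sum_(t : q.-tuple 'I_m | uniq t)
    (\prod_(i <- t) p i) / (\prod_(1 <= r < q.+1) comp_prob (take r t)).

End TupleSum.

(* Main.v *)
(* Up to a null set, X_k is the number of times n at which exactly k - 1
   different values have been seen, so E[X_k] is the sum over n of the
   probabilities of these events.  Split each event according to the order
   (i_1, ..., i_q), q = k - 1, in which the values first appeared, and let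
   a_n(i_1, ..., i_q) be the resulting probability.  Conditioning on the last
   draw,
     a_(n+1)(i_1, ..., i_q) = (p_(i_1) + ... + p_(i_q)) a_n(i_1, ..., i_q)
                              + p_(i_q) a_n(i_1, ..., i_(q-1)),
   and summing over n gives
     p(i_1, ..., i_q) A(i_1, ..., i_q) = p_(i_q) A(i_1, ..., i_(q-1)),
   which unfolds to the product formula.  The finiteness of these sums yields,
   by Borel-Cantelli, that all m values are seen almost surely. *)

Require Import Defs.
From HB Require Import structures.
From mathcomp Require Import all_boot all_order all_algebra finmap.
From mathcomp Require Import all_classical all_reals all_analysis.
From mathcomp Require Import measurable_realfun.
From mathcomp Require Import zify ring lra.

Set Implicit Arguments.
Unset Strict Implicit.
Unset Printing Implicit Defensive.

Import Order.TTheory GRing.Theory Num.Theory.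
Import numFieldNormedType.Exports.

Local Open Scope classical_set_scope.
Local Open Scope ring_scope.

(** * Sums over words, and series under an affine recursion *)

Lemma big_tuple_cons (R : nmodType) (T : finType) (n : nat) (F : n.+1.-tuple T -> R) :
  \sum_(s : n.+1.-tuple T) F s =
  \sum_(y : T) \sum_(s : n.-tuple T) F [tuple of y :: s].
Proof.
rewrite pair_big /=.
rewrite (reindex (fun q : T * n.-tuple T => [tuple of q.1 :: q.2])) //=.
exists (fun s => (thead s, [tuple of behead s])) => [[y s] _ | s _] /=.
  by congr pair; apply: val_inj.
by rewrite -tuple_eta.
Qed.

Section AffineRecursion.
Variable R : realType.
Implicit Types u v : R^nat.

(** Summing the recursion gives [U (n+1) = u 0 + c * U n + V n] for the partial sums. As [U] is
    nondecreasing, this yields [(1 - c) * U n <= u 0 + V], hence convergence, and the limit is the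
    fixed point of the summed recursion. *)
Lemma cvg_series_affine_recursion u v (c V : R) :
  0 <= c < 1 -> (forall n, 0 <= u n) -> (forall n, 0 <= v n) ->
  (forall n, u n.+1 = c * u n + v n) ->
  series v @ \oo --> V -> series u @ \oo --> (u 0%N + V) / (1 - c).
Proof.
move=> /andP[c_ge0 c_lt1] u_ge0 v_ge0 uE vV.
have d_gt0 : 0 < 1 - c by rewrite subr_gt0.
have rec n : series u n.+1 = u 0%N + c * series u n + series v n.
  elim: n => [|n IHn].
    by rewrite seriesSr !seriesEord /= !big_ord0 mulr0 !addr0 add0r.
  by rewrite seriesSr {1}IHn uE (seriesSr u) (seriesSr v); ring.
have v_le n : series v n <= V.
  rewrite -(cvg_lim _ vV) //.
  apply: nondecreasing_cvgn_le; last by apply/cvg_ex; exists V.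
  exact: nondecreasing_series.
have u_nd : nondecreasing_seq (series u) by exact: nondecreasing_series.
have u_cvg : cvgn (series u).
  apply: nondecreasing_is_cvgn => //; exists ((u 0%N + V) / (1 - c)) => _ [n _ <-].
  rewrite ler_pdivlMr //.
  have := u_nd _ _ (leqnSn n); rewrite rec; have := v_le n; lra.
have lim_rec : series u n.+1 @[n --> \oo] --> u 0%N + c * limn (series u) + V.
  rewrite (_ : (fun n => _) = fun n => u 0%N + c * series u n + series v n).
    apply: cvgD => //; apply: cvgD; first exact: cvg_cst.
    by apply: cvgM => //; exact: cvg_cst.
  by apply/funext.
have -> : (u 0%N + V) / (1 - c) = limn (series u) => //.
have lim_shift : series u n.+1 @[n --> \oo] --> limn (series u).
  by move: u_cvg; rewrite -(cvg_shiftS (series u)).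
have : limn (series u) = u 0%N + c * limn (series u) + V.
  by apply: cvg_unique lim_shift lim_rec.
move=> L; apply: (mulIf (lt0r_neq0 d_gt0)); rewrite divfK ?lt0r_neq0 //.
by move: L; lra.
Qed.

End AffineRecursion.

(** * Words weighted by [p], sorted by order of first appearance *)

Section FirstAppearance.
Context {R : realType} {m : nat}.
Variable p : 'I_m -> R.
Hypothesis p_gt0 : forall i, 0 < p i.
Hypothesis p_sum1 : \sum_(i < m) p i = 1.

(* Words of draws and lists of distinct values are read backwards, the most
   recent first, so that [undup], which keeps last occurrences, lists the values
   in the reverse order of their first appearance. *)
Definition appearance_prob (n : nat) (t : seq 'I_m) : R :=
  \sum_(s : n.-tuple 'I_m | undup s == t) \prod_(i <- s) p i.

Lemma appearance_prob_ge0 n t : 0 <= appearance_prob n t.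
Proof. by apply: sumr_ge0 => s _; apply: prodr_ge0 => i _; exact: ltW. Qed.

Lemma appearance_prob0 t : appearance_prob 0 t = (t == [::])%:R.
Proof.
rewrite /appearance_prob big_mkcond /= (eq_bigr (fun=> (t == [::])%:R)).
  by rewrite sumr_const card_tuple expn0 mulr1n.
by move=> s _; rewrite tuple0 /= big_nil eq_sym; case: ifP.
Qed.

Lemma appearance_prob_nil n : appearance_prob n.+1 [::] = 0.
Proof.
rewrite /appearance_prob big1 // => s /eqP s0.
have := mem_undup s (thead s); rewrite s0 in_nil.
by rewrite (tuple_eta s) mem_head.
Qed.

(** The newest draw [y] either repeats a value already listed or is the new value [x]. The two cases
    exclude each other because [x] is not in [t], so the indicators add up. *)
Lemma undup_cons_eq (T : eqType) (x y : T) (s t : seq T) : x \notin t ->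
  (undup (y :: s) == x :: t :> seq T)%:R =
  (y \in x :: t)%:R * (undup s == x :: t)%:R + (y == x)%:R * (undup s == t)%:R :> R.
Proof.
move=> xt /=.
have [ys|ys] := boolP (y \in s).
  have -> : (y == x)%:R * (undup s == t)%:R = 0 :> R.
    case: eqP => [yx|_]; last by rewrite mul0r.
    case: eqP => [st|_]; last by rewrite mulr0.
    by move: xt; rewrite -st mem_undup -yx ys.
  rewrite addr0; case: eqP => [st|_]; last by rewrite mulr0.
  by rewrite -st mem_undup ys mulr1.
have -> : (y \in x :: t)%:R * (undup s == x :: t)%:R = 0 :> R.
  case: eqP => [st|_]; last by rewrite mulr0.
  by rewrite -st mem_undup (negbTE ys) mul0r.
by rewrite add0r eqseq_cons -natrM mulnb.
Qed.

Lemma appearance_prob_cons n x t : uniq (x :: t) ->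
  appearance_prob n.+1 (x :: t) =
  (\sum_(i <- x :: t) p i) * appearance_prob n (x :: t)
  + p x * appearance_prob n t.
Proof.
move=> xt; have /andP[x_t _] := xt.
rewrite (big_uniq _ xt) /= /appearance_prob.
pose w (s : seq 'I_m) : R := \prod_(i <- s) p i.
(* Constraints become 0/1 factors, so that [undup_cons_eq] can be applied word by word. *)
have E k (Q : pred (seq 'I_m)) :
    \sum_(s : k.-tuple 'I_m | Q s) w s = \sum_(s : k.-tuple 'I_m) (Q s)%:R * w s.
  by rewrite big_mkcond; apply: eq_bigr => s _; case: (Q s); rewrite ?mul1r ?mul0r.
rewrite (E _ (fun s => undup s == x :: t)) (E _ (fun s => undup s == x :: t)).
rewrite (E _ (fun s => undup s == t)) big_tuple_cons.
rewrite [X in X * _]big_mkcond mulr_suml.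
(* The factor [p x] is spread over all possible last draws [y], to match the other two sums term by
   term. *)
rewrite [p x * _](_ : _ = \sum_(y : 'I_m) (y == x)%:R * p y *
    \sum_(s : n.-tuple 'I_m) (undup s == t)%:R * w s); last first.
  rewrite (bigD1 x) //= eqxx mul1r [X in _ + X]big1 ?addr0 // => y /negbTE ->.
  by rewrite !mul0r.
rewrite -big_split; apply: eq_bigr => y _ /=.
rewrite !mulr_sumr -big_split; apply: eq_bigr => s _ /=.
rewrite -/(undup (y :: s)) undup_cons_eq // {1}/w big_cons -/(w s).
by case: (y \in x :: t); case: (y == x); rewrite ?mul1r ?mul0r; ring.
Qed.

Fixpoint expected_stay (t : seq 'I_m) : R :=
  if t is x :: t' then p x * expected_stay t' / comp_prob p t else 1.

Lemma comp_probE (t : seq 'I_m) : uniq t ->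
  comp_prob p t = \sum_(i | i \notin t) p i.
Proof.
move=> t_uniq; rewrite /comp_prob (big_uniq _ t_uniq) -p_sum1 (bigID (mem t)) /=.
by rewrite addrC addrK.
Qed.

Lemma comp_prob_gt0 (t : seq 'I_m) : uniq t -> (size t < m)%N ->
  0 < comp_prob p t.
Proof.
move=> t_uniq t_lt; rewrite comp_probE //.
have /existsP[i it] : [exists i, i \notin t].
  apply: contraLR t_lt; rewrite negb_exists => /forallP t_all.
  rewrite -leqNgt -(card_uniqP t_uniq) -[leqLHS]card_ord.
  by apply/subset_leq_card/fintype.subsetP => i _; have := t_all i; rewrite negbK.
rewrite (bigD1 i) //= ltr_pwDl // sumr_ge0 // => j _; exact: ltW.
Qed.

(* The expected time during which [t] is the list of values seen is
   [expected_stay t]: the last value of the list is hit at rate [p x] from the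
   shorter list, and [t] is then left at rate [comp_prob p t]. *)
Lemma cvg_series_appearance_prob (t : seq 'I_m) : uniq t -> (size t < m)%N ->
  series (appearance_prob ^~ t) @ \oo --> expected_stay t.
Proof.
elim: t => [|x t IHt] t_uniq t_lt.
  (* The empty list has probability 1 at time 0 and 0 afterwards, hence [c = 0] and [v = 0]. *)
  have := @cvg_series_affine_recursion R (appearance_prob ^~ [::]) (fun=> 0) 0 0.
  rewrite appearance_prob0 eqxx addr0 subr0 divr1; apply => //.
  - by rewrite lexx ltr01.
  - by move=> n; exact: appearance_prob_ge0.
  - by move=> n; rewrite appearance_prob_nil mul0r addr0.
  - rewrite (_ : series _ = fun=> 0); first exact: cvg_cst.
    by apply/funext => n; rewrite seriesEord /= big1.
have /andP[x_t t_uniq'] := t_uniq.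
have d_gt0 := comp_prob_gt0 t_uniq t_lt.
have := @cvg_series_affine_recursion R (appearance_prob ^~ (x :: t))
  (fun n => p x * appearance_prob n t) (\sum_(i <- x :: t) p i) (p x * expected_stay t).
rewrite appearance_prob0 add0r; apply.
- rewrite sumr_ge0 /=; last by move=> i _; exact: ltW.
  by rewrite -subr_gt0.
- by move=> n; exact: appearance_prob_ge0.
- by move=> n; rewrite mulr_ge0 ?appearance_prob_ge0 // ltW.
- by move=> n; exact: appearance_prob_cons.
- rewrite (_ : series _ = fun n => p x * series (appearance_prob ^~ t) n).
    by apply: cvgM; [exact: cvg_cst|apply: IHt => //; exact: ltnW].
  by apply/funext => n; rewrite !seriesEord /= mulr_sumr.
Qed.

(** Tails of [t] are, up to order, prefixes of [rev t], and [comp_prob] ignores the order of its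
    entries; the head [x] contributes the last factor of each product. *)
Lemma expected_stayE (t : seq 'I_m) :
  expected_stay t = (\prod_(i <- rev t) p i) /
    (\prod_(1 <= r < (size t).+1) comp_prob p (take r (rev t))).
Proof.
elim: t => [|x t IHt]; first by rewrite /= big_nil big_geq // divr1.
have rev_xt : rev (x :: t) = rev t ++ [:: x] by rewrite rev_cons cats1.
rewrite rev_xt [LHS]/= IHt [in RHS]big_nat_recr //= big_cat big_seq1 /=.
rewrite take_oversize ?size_cat ?size_rev ?addn1 //.
rewrite (_ : \prod_(1 <= r < (size t).+1) comp_prob p (take r (rev t ++ [:: x])) =
  \prod_(1 <= r < (size t).+1) comp_prob p (take r (rev t))); last first.
  by apply: eq_big_nat => r /andP[_ r_lt]; rewrite takel_cat // size_rev.
have -> : comp_prob p (rev t ++ [:: x]) = comp_prob p (x :: t).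
  by congr (1 - _); apply: perm_big; rewrite cats1 -rev_cons perm_rev.
by rewrite invfM; ring.
Qed.

Lemma rev_tuple_inj n : injective (fun t : n.-tuple 'I_m => [tuple of rev t]).
Proof. by move=> t u /(congr1 val) /= /(can_inj revK); exact: val_inj. Qed.

Lemma distinct_sumE q :
  distinct_sum p q = \sum_(t : q.-tuple 'I_m | uniq t) expected_stay t.
Proof.
rewrite /distinct_sum (reindex_inj (@rev_tuple_inj q)) /=.
by apply: eq_big => t; rewrite ?rev_uniq // expected_stayE size_tuple.
Qed.

(** The law of the number of values seen, at the level of words; [prob_nb_seen] makes the link with
    [P]. *)
Definition nb_distinct_prob (n q : nat) : R :=
  \sum_(s : n.-tuple 'I_m | size (undup s) == q) \prod_(i <- s) p i.

Lemma nb_distinct_probE n q :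
  nb_distinct_prob n q = \sum_(t : q.-tuple 'I_m | uniq t) appearance_prob n t.
Proof.
rewrite /appearance_prob (exchange_big_dep (fun s : n.-tuple 'I_m => size (undup s) == q)) /=.
  (* Each word [s] contributes to exactly one [t], namely [undup s]. *)
  apply: eq_bigr => s sq; rewrite (big_pred1 (Tuple sq)) // => t.
  rewrite /= -val_eqE /= andbC eq_sym; case: eqP => //= ->; exact: undup_uniq.
by move=> t s _ /eqP ->; rewrite size_tuple.
Qed.

Lemma cvg_series_nb_distinct_prob q : (q < m)%N ->
  series (nb_distinct_prob ^~ q) @ \oo --> distinct_sum p q.
Proof.
move=> q_lt; rewrite distinct_sumE.
rewrite (_ : series _ = fun n => \sum_(t : q.-tuple 'I_m | uniq t)
    series (appearance_prob ^~ t) n).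
  apply: cvg_big => [|t t_uniq]; first exact: add_continuous.
  by apply: cvg_series_appearance_prob; rewrite ?size_tuple.
apply/funext => n; rewrite seriesEord /=.
under eq_bigr do rewrite nb_distinct_probE.
by rewrite exchange_big; apply: eq_bigr => t _; rewrite seriesEord.
Qed.

End FirstAppearance.

(** * Collection times along a single sample path *)

Section Draws.
Context {Omega : Type} {R : realType} {m : nat}.
Variable xi : nat -> Omega -> 'I_m.

Definition past_draws (n : nat) (w : Omega) : seq 'I_m :=
  rev (mkseq (fun i => xi i w) n).

Lemma past_drawsS n w : past_draws n.+1 w = xi n w :: past_draws n w.
Proof. by rewrite /past_draws mkseqS rev_rcons. Qed.

Lemma size_past_draws n w : size (past_draws n w) = n.
Proof. by rewrite size_rev size_mkseq. Qed.

Lemma nb_seenE n w : nb_seen xi n w = size (undup (past_draws n w)).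
Proof.
rewrite /nb_seen -(card_uniqP (undup_uniq _)); apply: eq_card => y.
rewrite mem_undup mem_rev; apply/mapP/mapP => -[i].
  by move=> _ ->; exists (val i) => //; rewrite mem_iota /=.
by rewrite mem_iota /= add0n => i_lt ->; exists (Ordinal i_lt); rewrite ?mem_enum.
Qed.

Lemma nb_seen0 w : nb_seen xi 0 w = 0%N.
Proof. by rewrite nb_seenE. Qed.

Lemma nb_seenS n w : (nb_seen xi n w <= nb_seen xi n.+1 w <= (nb_seen xi n w).+1)%N.
Proof. by rewrite !nb_seenE past_drawsS /=; case: ifP => _ /=; rewrite ?leqnn ?leqnSn. Qed.

Lemma nb_seen_homo w : {homo (fun n => nb_seen xi n w) : a b / (a <= b)%N}.
Proof.
by apply: homo_leq leqnn leq_trans _ => n; have /andP[] := nb_seenS n w.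
Qed.

(** The count is nondecreasing, so the times spent below level [q] form an initial segment; its
    length [N] is the hitting time of the level. *)
Lemma nb_seen_ltE q w : (exists n, (q <= nb_seen xi n w)%N) ->
  exists N, forall n, (nb_seen xi n w < q)%N = (n < N)%N.
Proof.
move=> ex_q; exists (ex_minn ex_q) => n.
case: ex_minnP => N N_ge N_min.
apply/idP/idP; first by apply: contraTT; rewrite -!leqNgt => /(nb_seen_homo w); exact: leq_trans.
by apply: contraTT; rewrite -!leqNgt; exact: N_min.
Qed.

Lemma collection_timeE j w (N : nat) :
  (forall n, (nb_seen xi n w < j)%N = (n < N)%N) ->
  collection_time R xi j w = N%:R.
Proof.
case: j => [|j] f_lt; first by case: N f_lt => // N /(_ 0%N); rewrite ltn0 ltnS.
case: N f_lt => [/(_ 0%N)|N f_lt]; first by rewrite nb_seen0.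
(* The count grows by at most one per draw, so it cannot jump over [j.+1]: the level is attained
   exactly at its hitting time. *)
have f_eq : nb_seen xi N.+1 w = j.+1.
  have := f_lt N; have := f_lt N.+1; rewrite ltnn ltnSn.
  by have := nb_seenS N w; lia.
have N_lb : lbound [set n%:R | n in [set n : nat | (1 <= n)%N /\ nb_seen xi n w = j.+1]]
    (N.+1%:R : R).
  by move=> _ [n [_ fn] <-]; rewrite ler_nat leqNgt -f_lt fn ltnn.
rewrite /collection_time; apply/eqP; rewrite eq_le; apply/andP; split.
  by apply: ge_inf; [exists N.+1%:R|exists N.+1].
by apply: lb_le_inf => //; exists N.+1%:R, N.+1.
Qed.

(** Exactly [q] values have been seen at the times [N <= n < N'] between the two hitting times, so
    the indicator series counts [N' - N]. *)
Lemma waiting_timeE q w : (exists n, (q.+1 <= nb_seen xi n w)%N) ->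
  (waiting_time R xi q.+1 w)%:E =
  (\sum_(0 <= n <oo) (\1_[set w | nb_seen xi n w = q] w)%:E)%E.
Proof.
move=> ex_q1; have [N' f_lt'] := nb_seen_ltE ex_q1.
have [N f_lt] : exists N, forall n, (nb_seen xi n w < q)%N = (n < N)%N.
  by apply: nb_seen_ltE; case: ex_q1 => n /ltnW; exists n.
have NN' : (N <= N')%N.
  by rewrite leqNgt; apply/negP => lt_NN'; have := f_lt N'; have := f_lt' N'; lia.
rewrite /waiting_time (collection_timeE f_lt') (collection_timeE f_lt).
have termE n : \1_[set w | nb_seen xi n w = q] w = ((N <= n < N')%N)%:R :> R.
  rewrite indicE; congr ((nat_of_bool _)%:R).
  have := f_lt n; have := f_lt' n => l' l.
  by apply/idP/idP => [/set_mem /=|fn]; [|apply/mem_set => /=]; lia.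
under eq_eseriesr do rewrite termE.
rewrite (@nneseries_split _ _ 0 N') ?add0n //.
rewrite [X in (_ + X)%E]eseries0 ?adde0; last first.
  by move=> n /= n_ge _; rewrite [(n < N')%N]ltnNge n_ge andbF.
rewrite sumEFin (big_cat_nat (leq0n N)) //= big_nat big1 ?add0r; last first.
  by move=> n /andP[_ n_lt]; rewrite leqNgt n_lt.
rewrite (eq_big_nat _ _ (F2 := fun=> 1)); last by move=> n ->.
by rewrite sumr_const_nat natrB.
Qed.

End Draws.

(** * Measurability of the past and of the collection times *)

Section CouponCollector.
Context {R : realType} {m : nat} {d : measure_display} {Omega : measurableType d}.
Variables (P : probability Omega R) (xi : nat -> Omega -> 'I_m).
Hypothesis xi_rv : forall n, finite_valued_rv (xi n).

(** A finite intersection of this shape is what independence applies to. The default [x0] of [nth]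
    is later taken to be the head of the word, which is why empty words are treated apart. *)
Lemma past_draws_cylinder (x0 : 'I_m) n (s : n.-tuple 'I_m) :
  [set w | past_draws xi n w = s] =
  \bigcap_(i in [set` [fset i in iota 0 n]%fset]) xi i @^-1` [set nth x0 (rev s) i].
Proof.
apply/seteqP; split => w /=.
  move=> ws i /=; rewrite !inE /= mem_iota add0n => i_lt.
  by rewrite -ws revK nth_mkseq.
move=> ws; apply: (can_inj revK); rewrite revK.
apply: (@eq_from_nth _ x0); first by rewrite size_mkseq size_rev size_tuple.
move=> i; rewrite size_mkseq => i_lt; rewrite nth_mkseq //.
by apply: ws; rewrite /= !inE /= mem_iota.
Qed.

Lemma measurable_past_draws_eq n (s : n.-tuple 'I_m) :
  measurable [set w | past_draws xi n w = s].
Proof.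
case: n s => [|n] s.
  rewrite (_ : [set _ | _] = setT) //.
  by apply/seteqP; split => // w _ /=; rewrite tuple0.
rewrite (past_draws_cylinder (thead s)).
by apply: fin_bigcap_measurable => // i _; exact: xi_rv.
Qed.

Lemma measurable_past_draws n (B : pred (seq 'I_m)) :
  measurable [set w | B (past_draws xi n w)].
Proof.
rewrite (_ : [set _ | _] = \bigcup_(s in [set s : n.-tuple 'I_m | B s])
    [set w | past_draws xi n w = s]).
  by apply: fin_bigcup_measurable => // s _; exact: measurable_past_draws_eq.
apply/seteqP; split => w /=.
  move=> Bw; have ws : size (past_draws xi n w) == n by rewrite size_past_draws.
  by exists (Tuple ws).
by move=> [s /= Bs ->].
Qed.

Lemma measurable_nb_seen n q : measurable [set w | nb_seen xi n w = q].
Proof.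
rewrite (_ : [set _ | _] = [set w | size (undup (past_draws xi n w)) == q]).
  exact: (measurable_past_draws n (fun s => size (undup s) == q)).
by apply/seteqP; split => w /=; rewrite nb_seenE => /eqP.
Qed.

Lemma measurable_collection_time j : measurable_fun setT (collection_time R xi j).
Proof.
(* [H N] is the event that level [j] is first reached at time [N]. Off the union of these events the
   level is never reached and [collection_time] has its default value 0, so every preimage is a
   countable combination of measurable sets. *)
pose H N := \bigcap_n [set w | (size (undup (past_draws xi n w)) < j)%N == (n < N)%N].
have HE N w : H N w -> forall n, (nb_seen xi n w < j)%N = (n < N)%N.
  by move=> Hw n; rewrite nb_seenE; have /= /eqP := Hw n I.
have mH N : measurable (H N).
  apply: bigcap_measurableType => n _.
  exact: (measurable_past_draws n (fun s => (size (undup s) < j)%N == (n < N)%N)).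
move=> _ Y _; rewrite setTI.
rewrite (_ : _ @^-1` Y = \bigcup_(N in [set N : nat | Y N%:R]) H N
    `|` (~` (\bigcup_N H N) `&` [set _ | Y 0])).
  apply: measurableU; first exact: bigcup_measurable.
  apply: measurableI; first by apply: measurableC; exact: bigcup_measurable.
  have [Y0|nY0] := pselect (Y 0).
    by rewrite (_ : [set _ | _] = setT) //; apply/seteqP; split.
  by rewrite (_ : [set _ | _] = set0) //; apply/seteqP; split.
have unreached w : ~ (exists N, H N w) -> collection_time R xi j w = 0.
  move=> never; have lt_j n : (nb_seen xi n w < j)%N.
    rewrite ltnNge; apply/negP => j_le; apply: never.
    have [|N f_lt] := @nb_seen_ltE _ _ xi j w; first by exists n.
    by exists N => i _ /=; rewrite -nb_seenE f_lt.
  clear HE mH never H; case: j lt_j => // j lt_j; rewrite /collection_time.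
  rewrite (_ : [set _ | _ in _] = set0) ?inf0 //.
  by apply/seteqP; split => // y [n [_ fn] _]; have := lt_j n; rewrite fn ltnn.
apply/seteqP; split => w /=.
  have [[N HN]|never] := pselect (exists N, H N w).
    by rewrite (collection_timeE (HE _ _ HN)) => YN; left; exists N.
  rewrite unreached // => Y0; right; split => // -[N _ HN]; apply: never.
  by exists N.
case=> [[N YN HN]|[never Y0]]; first by rewrite (collection_timeE (HE _ _ HN)).
by rewrite unreached // => -[N HN]; apply: never; exists N.
Qed.

Lemma measurable_waiting_time j : measurable_fun setT (waiting_time R xi j).
Proof. by apply: measurable_funB; exact: measurable_collection_time. Qed.

(** * Probabilities of words under independence *)

Variable p : 'I_m -> R.
Hypothesis xi_law : forall n i, P (xi n @^-1` [set i]) = (p i)%:E.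
Hypothesis xi_indep : mutually_independent P xi.

Lemma prob_past_draws_eq n (s : n.-tuple 'I_m) :
  P [set w | past_draws xi n w = s] = (\prod_(i <- s) p i)%:E.
Proof.
case: n s => [|n] s.
  rewrite (_ : [set _ | _] = setT).
    by rewrite tuple0 big_nil probability_setT.
  by apply/seteqP; split => // w _ /=; rewrite tuple0.
rewrite (past_draws_cylinder (thead s)) xi_indep.
rewrite (perm_big (iota 0 n.+1)); last first.
  apply: uniq_perm => [||i]; [exact: fset_uniq|exact: (iota_uniq 0 n.+1)|].
  by rewrite !inE.
under eq_bigr do rewrite xi_law.
rewrite prodEFin -(big_map (nth (thead s) (rev s)) xpredT p) map_nth_iota0.
  by rewrite take_oversize ?size_rev ?size_tuple // (perm_big s) // perm_rev.
by rewrite size_rev size_tuple.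
Qed.

Lemma prob_past_draws n (B : pred (seq 'I_m)) :
  P [set w | B (past_draws xi n w)] =
  (\sum_(s : n.-tuple 'I_m | B s) \prod_(i <- s) p i)%:E.
Proof.
rewrite (_ : [set _ | _] =
    \bigcup_(s in [set` [seq s : n.-tuple 'I_m <- enum {: n.-tuple 'I_m} | B s]])
    [set w | past_draws xi n w = s]); last first.
  apply/seteqP; split => w /=.
    move=> Bw; have ws : size (past_draws xi n w) == n by rewrite size_past_draws.
    by exists (Tuple ws) => //=; rewrite mem_filter Bw mem_enum.
  by move=> [s /=]; rewrite mem_filter => /andP[Bs _] ->.
rewrite measure_fin_bigcup //; last 2 first.
- by move=> s t _ _ [w /= [-> /val_inj]].
- by move=> s _; exact: measurable_past_draws_eq.
rewrite -fsbig_seq; last by apply: filter_uniq; exact: enum_uniq.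
rewrite big_filter big_enum_cond /=.
by under eq_bigr do rewrite prob_past_draws_eq; rewrite sumEFin.
Qed.

Lemma prob_nb_seen n q :
  P [set w | nb_seen xi n w = q] = (nb_distinct_prob p n q)%:E.
Proof.
rewrite (_ : [set _ | _] = [set w | size (undup (past_draws xi n w)) == q]).
  exact: (prob_past_draws n (fun s => size (undup s) == q)).
by apply/seteqP; split => w /=; rewrite nb_seenE => /eqP.
Qed.

(** * Almost sure collection of all values, and expectations *)

Hypothesis p_gt0 : forall i, 0 < p i.
Hypothesis p_sum1 : \sum_(i < m) p i = 1.

Lemma nneseries_prob_nb_seen q : (q < m)%N ->
  (\sum_(0 <= n <oo) P [set w | nb_seen xi n w = q] = (distinct_sum p q)%:E)%E.
Proof.
move=> q_lt; under eq_eseriesr do rewrite prob_nb_seen.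
apply/cvg_lim => //; under eq_fun do rewrite sumEFin.
apply: cvg_EFin; first exact: nearW.
exact: (cvg_series_nb_distinct_prob p_gt0 p_sum1 q_lt).
Qed.

(** By induction, level [q] is almost surely reached. The probabilities of the count being [q] are
    summable, so by Borel-Cantelli it is almost surely equal to [q] only finitely often; if it never
    reached [q.+1] it would stay at [q] forever. *)
Lemma ae_nb_seen_ge q : (q <= m)%N ->
  \forall w \ae P, exists n, (q <= nb_seen xi n w)%N.
Proof.
elim: q => [_|q IHq q_lt]; first by apply: aeW => w; exists 0%N.
have lim_sup0 : P (lim_sup_set (fun n => [set w | nb_seen xi n w = q])) = 0%E.
  apply: lim_sup_set_cvg0 => [n|]; first exact: measurable_nb_seen.
  by rewrite nneseries_prob_nb_seen // ltry.
have ae_leave : \forall w \ae P,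
    ~ lim_sup_set (fun n => [set w | nb_seen xi n w = q]) w.
  exists (lim_sup_set (fun n => [set w | nb_seen xi n w = q])).
  split=> [||w /contrapT //] //; apply: bigcap_measurableType => n _.
  by apply: bigcup_measurable => i _; exact: measurable_nb_seen.
apply: filterS2 (IHq (ltnW q_lt)) ae_leave => w [n0 q_le] leave.
apply: contrapT => never; apply: leave => n _ /=.
exists (maxn n n0); first exact: leq_maxl.
apply/eqP; rewrite /= eqn_leq; apply/andP; split.
  by rewrite -ltnS ltnNge; apply/negP => lt_q; apply: never; exists (maxn n n0).
by apply: leq_trans q_le _; apply: nb_seen_homo; exact: leq_maxr.
Qed.

(** An everywhere nonnegative, possibly infinite stand-in for [waiting_time] at [q.+1], whose
    integral can be computed term by term. *)
Definition time_at (q : nat) (w : Omega) : \bar R :=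
  (\sum_(0 <= n <oo) (\1_[set w | nb_seen xi n w = q] w)%:E)%E.

Lemma measurable_indic_nb_seen n q :
  measurable_fun setT (fun w => (\1_[set w | nb_seen xi n w = q] w)%:E : \bar R).
Proof. by apply/measurable_EFinP/measurable_indic/measurable_nb_seen. Qed.

Lemma time_at_ge0 q w : (0 <= time_at q w)%E.
Proof. by apply: nneseries_ge0 => n _ _; rewrite lee_fin. Qed.

Lemma measurable_time_at q : measurable_fun setT (time_at q).
Proof.
apply: (@ge0_emeasurable_sum _ _ _ _ _ xpredT) => // n _.
exact: measurable_indic_nb_seen.
Qed.

Lemma integral_time_at q : (q < m)%N ->
  (\int[P]_w time_at q w = (distinct_sum p q)%:E)%E.
Proof.
move=> q_lt; rewrite integral_nneseries //; first 1 last.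
- by move=> n; exact: measurable_indic_nb_seen.
rewrite -nneseries_prob_nb_seen //; apply: eq_eseriesr => n _.
by rewrite integral_indic ?setIT //; exact: measurable_nb_seen.
Qed.

Lemma ae_waiting_time : \forall w \ae P, forall q, (q < m)%N ->
  (waiting_time R xi q.+1 w)%:E = time_at q w.
Proof.
apply: filterS (ae_nb_seen_ge (leqnn m)) => w [n n_ge] q q_lt.
by apply: waiting_timeE; exists n; exact: leq_trans n_ge.
Qed.

Lemma expectation_waiting_time q : (q < m)%N ->
  ('E_P[waiting_time R xi q.+1] = (distinct_sum p q)%:E)%E.
Proof.
move=> q_lt; rewrite unlock -integral_time_at //.
apply: ae_eq_integral => //.
- by apply/measurable_EFinP; exact: measurable_waiting_time.
- exact: measurable_time_at.
by apply: filterS ae_waiting_time => w wE _; exact: wE.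
Qed.

(** [waiting_time] can be negative where a level is never reached, so sum and integral are exchanged
    on the nonnegative [time_at q], and the result is carried over by almost everywhere equality. *)
Lemma expectation_nb_draws k : (k <= m)%N ->
  ('E_P[nb_draws R xi k] = \sum_(1 <= s < k.+1) 'E_P[waiting_time R xi s])%E.
Proof.
move=> k_le; rewrite big_add1 /=.
rewrite (eq_big_nat _ _ (F2 := fun q => \int[P]_w time_at q w)%E); last first.
  move=> q /andP[_ q_lt]; have q_m := leq_trans q_lt k_le.
  by rewrite expectation_waiting_time ?integral_time_at.
rewrite -ge0_integral_sum //; last 2 first.
- by move=> q; exact: measurable_time_at.
- by move=> q w _; exact: time_at_ge0.
rewrite unlock; apply: ae_eq_integral => //.
- apply/measurable_EFinP; rewrite /nb_draws.
  by apply: measurable_sum => s; exact: measurable_waiting_time.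
- by apply: emeasurable_sum => q; exact: measurable_time_at.
apply: filterS ae_waiting_time => w wE _.
rewrite /nb_draws big_add1 /= -sumEFin; apply: eq_big_nat => q /andP[_ q_lt].
by rewrite wE // (leq_trans q_lt).
Qed.

End CouponCollector.

(** Only the empty tuple contributes; this is the expectation of [X_1] and gives the leading 1 of
    the final formula. *)
Lemma distinct_sum0 (R : realType) (m : nat) (p : 'I_m -> R) : distinct_sum p 0 = 1.
Proof.
rewrite /distinct_sum (big_pred1 [tuple]) => [|t]; last by rewrite tuple0.
by rewrite big_nil big_geq // divr1.
Qed.

Theorem proposition2 (R : realType) (m : nat) (hm : (2 <= m)%N)
    (p : 'I_m -> R) (p_gt0 : forall i, 0 < p i) (p_sum1 : \sum_(i < m) p i = 1)
    (d : measure_display) (Omega : measurableType d) (P : probability Omega R)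
    (xi : nat -> Omega -> 'I_m)
    (xi_rv : forall n, finite_valued_rv (xi n))
    (xi_law : forall n i, P (xi n @^-1` [set i]) = (p i)%:E)
    (xi_indep : mutually_independent P xi)
    (k : nat) (hk : (2 <= k <= m)%N) :
  ('E_P[waiting_time R xi k] = (distinct_sum p k.-1)%:E)%E /\
  ('E_P[nb_draws R xi k] = \sum_(1 <= s < k.+1) 'E_P[waiting_time R xi s])%E /\
  ('E_P[nb_draws R xi k] =
     (1 + \sum_(2 <= s < k.+1) distinct_sum p s.-1)%R%:E)%E.
Proof.
have k_gt0 : (0 < k)%N by case/andP: hk => /ltnW.
have k_le : (k <= m)%N by case/andP: hk.
have EX s : (0 < s <= m)%N -> ('E_P[waiting_time R xi s] = (distinct_sum p s.-1)%:E)%E.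
  by case: s => // q; exact: (expectation_waiting_time xi_rv xi_law xi_indep).
have EXk := expectation_nb_draws xi_rv xi_law xi_indep p_gt0 p_sum1 k_le.
split; first by rewrite EX ?k_gt0.
split=> //; rewrite EXk.
rewrite (eq_big_nat _ _ (F2 := fun s => (distinct_sum p s.-1)%:E)); last first.
  by move=> s /andP[s_gt0 s_lt]; rewrite EX // s_gt0 (leq_trans _ k_le).
by rewrite sumEFin big_ltn //= distinct_sum0.
Qed.
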